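(* Let $0\le\ell<u$ and $p>2$. Then the function $h_p(\xi_1):=C-\operatorname{vol}(\breve{U}^*_p(\ell,\xi_1,u))$, $\xi_1\in(\ell,u)$, is strictly log-concave, where $$C=\frac{\big((p-1)u^p+\ell^p-pu^{p-1}\ell\big)\big(u^p+(p-1)\ell^p-pu\ell^{p-1}\big)}{6p(u^{p-1}-\ell^{p-1})}.$$
   Context: Let $f(x):=x^p$ on $[\ell,u]$, and $(\xi_0,\xi_1,\xi_2):=(\ell,\xi_1,u)$ with $\ell<\xi_1<u$. For $i=1,2$ put $$\tau_i:=\frac{[f(\xi_i)-f'(\xi_i)\xi_i]-[f(\xi_{i-1})-f'(\xi_{i-1})\xi_{i-1}]}{f'(\xi_{i-1})-f'(\xi_i)},$$ the abscissa of the intersection of the tangent lines to $f$ at $\xi_{i-1}$ and $\xi_i$. Let $g:[\ell,u]\to\mathbb{R}$ be the piecewise-linear function whose graph connects, in order, $(\ell,f(\ell))$, the points $(\tau_i,\ f(\xi_i)+f'(\xi_i)(\tau_i-\xi_i))$ for $i=1,2$, and $(u,f(u))$. With $s:=\frac{f(u)-f(\ell)}{u-\ell}$, the set $\breve{U}^*_p(\ell,\xi_1,u)$ is the closure of the convex hull of $$\left\{(x,y,z)\in\mathbb{R}^3:\ (f(\ell)-s\ell)z+sx\ge y\ge z\,g(x/z),\ uz\ge x\ge \ell z,\ 1\ge z>0,\ y\ge 0\right\}.$$ $\operatorname{vol}$ denotes 3-dimensional volume. A positive function is strictly log-concave if its logarithm is strictly concave. *)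

(* Defs.v *)
From HB Require Import structures.
From mathcomp Require Import all_boot all_order all_algebra.
From mathcomp Require Import all_classical all_reals all_analysis.

Set Implicit Arguments.
Unset Strict Implicit.
Unset Printing Implicit Defensive.

Import Order.TTheory GRing.Theory Num.Theory.
Import numFieldNormedType.Exports.

Local Open Scope classical_set_scope.
Local Open Scope ring_scope.

Definition strictly_concave_on (R : realType) (D : set R) (f : R -> R) : Prop :=
  forall x y t : R, D x -> D y -> x != y -> 0 < t -> t < 1 ->
    t * f x + (1 - t) * f y < f (t * x + (1 - t) * y).

Definition strictly_log_concave_on (R : realType) (D : set R) (f : R -> R)
    : Prop :=
  (forall x, D x -> 0 < f x) /\ strictly_concave_on D (fun x => ln (f x)).

(* The copies [R^o] of [R] carry the vector-space structure. *)
Definition convex_hull3 (R : realType) (A : set (R * R * R)) : set (R * R * R) :=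
  smallest (@convex_set R (R^o * R^o * R^o)%type) A.

Definition vol3 (R : realType) (A : set (R * R * R)) : R :=
  fine (((@lebesgue_measure R \x @lebesgue_measure R) \x @lebesgue_measure R)%E A).

(* The derivative of [x `^ p] on [0, +oo[.  It is written out because [powR] is
   constant on negative numbers, so that the two-sided derivative [^`()] is not
   meaningful at the endpoint 0; see [pow_diff_is_derive], [pow_diff_right0]. *)
Definition pow_diff (R : realType) (p x : R) : R := p * x `^ (p - 1).

Lemma pow_diff_is_derive (R : realType) (p x : R) : 0 < x ->
  is_derive x 1 (fun t : R => t `^ p) (pow_diff p x).
Proof. exact: is_derive1_powR. Qed.

Lemma pow_diff_right0 (R : realType) (p : R) : 1 < p ->
  h^-1 * (h `^ p - 0 `^ p) @[h --> 0^'+] --> pow_diff p 0.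
Proof.
move=> p1; have p10 : 0 < p - 1 by rewrite subr_gt0.
have p0 : 0 < p by exact: lt_trans p1.
rewrite /pow_diff (powR0 (lt0r_neq0 p10)) (powR0 (lt0r_neq0 p0)) mulr0.
apply: cvg_trans (powR_cvg0 p10); apply: near_eq_cvg; near=> h.
have h0 : 0 < h by near: h; exact: nbhs_right_gt.
by rewrite subr0 -(mulr_powRB1 (ltW h0) p0) mulKf ?gt_eqF.
Unshelve. all: by end_near. Qed.

(* Abscissa of the intersection of the tangents at [a] and [b]. *)
Definition tangent_meet (R : realType) (p a b : R) : R :=
  ((b `^ p - pow_diff p b * b) - (a `^ p - pow_diff p a * a)) /
  (pow_diff p a - pow_diff p b).

(* The line through [(a, ya)] and [(b, yb)]. *)
Definition line_through (R : realType) (a ya b yb x : R) : R :=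
  line_path ya yb (factor a b x).

Definition pw_under (R : realType) (p l xi u x : R) : R :=
  let tau1 := tangent_meet p l xi in
  let tau2 := tangent_meet p xi u in
  let y1 := xi `^ p + pow_diff p xi * (tau1 - xi) in
  let y2 := u `^ p + pow_diff p u * (tau2 - u) in
  if x <= tau1 then line_through l (l `^ p) tau1 y1 x
  else if x <= tau2 then line_through tau1 y1 tau2 y2 x
  else line_through tau2 y2 u (u `^ p) x.

Definition chord_slope (R : realType) (p l u : R) : R :=
  (u `^ p - l `^ p) / (u - l).

Definition Ubreve_base (R : realType) (p l xi u : R) : set (R * R * R) :=
  [set q | let: (x, y, z) := q in
    let s := chord_slope p l u in
    [/\ z * pw_under p l xi u (x / z) <= y <= (l `^ p - s * l) * z + s * x,
        l * z <= x <= u * z,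
        0 < z <= 1 &
        0 <= y]].

Definition Ubreve (R : realType) (p l xi u : R) : set (R * R * R) :=
  closure (convex_hull3 (Ubreve_base p l xi u)).

Definition Cconst (R : realType) (p l u : R) : R :=
  (((p - 1) * u `^ p + l `^ p - p * u `^ (p - 1) * l) *
   (u `^ p + (p - 1) * l `^ p - p * u * l `^ (p - 1))) /
  (6 * p * (u `^ (p - 1) - l `^ (p - 1))).

Definition hfun (R : realType) (p l u xi : R) : R :=
  Cconst p l u - vol3 (Ubreve p l xi u).

(* Main.v *)
From HB Require Import structures.
Require Import Defs.
From mathcomp Require Import all_boot all_order all_algebra.
From mathcomp Require Import all_classical all_reals all_analysis.
From mathcomp Require Import ring lra measurable_realfun interval_inference.

(** The set is the closure of a cone of height 1 over a convex polygon: the part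
    of the plane above the tangents to [x `^ p] at [l], [xi], [u] and below the
    chord between [l] and [u].  Its volume is one third of the area of the polygon
    ([vol3_Ubreve]).  The constant [C] is the corresponding value for the two
    outer tangents alone, so [h_p (xi)] is one third of the area of the triangle
    that the tangent at [xi] cuts off.  If [t], [t1], [t2] are the abscissae of
    the intersections of the tangents at [l] and [u], at [l] and [xi], at [xi]
    and [u], and [m0 < m2] are the slopes at [l] and [u], that area is
    [(m2 - m0) / 2 * (t - t1) * (t2 - t)] ([gap_area_tangents]).  Hence, up to an
    additive constant, [ln h_p] is [ln (t - t1) + ln (t2 - t)], and the two terms
    are treated separately.

    Put [q = p - 1 > 1].  As a function of [xi],
    [t1 = q / p * (xi + l `^ q * (xi - l) / (xi `^ q - l `^ q))] is convex, which
    a second derivative computation reduces to Young's inequality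
    ([convex_secant_reciprocal], [powR_ge_tangent]).  So [t - t1] is concave,
    positive and injective, and its logarithm is strictly concave
    ([ln_left_gap_strictly_concave]).

    The function [t2] is convex as well, so for [t2 - t] only log-concavity can
    be expected.  Here [t2 - t = q / p * (W (xi) - W (l))] with
    [W (x) = x `^ q * (u - x) / (u `^ q - x `^ q)].  The value [W (l)] is
    nonnegative, and subtracting a nonnegative constant preserves log-concavity
    ([ln_concave_subr]); it remains to see that [W] is log-concave between [0]
    and [u].  The sign of the second derivative of [ln W] follows from the lower bound
    [u `^ q - x `^ q >= q * (x * u) `^ ((q - 1) / 2) * (u - x)] and once more
    Young's inequality ([ln_weighted_secant_reciprocal_concave]). *)

Set Implicit Arguments.
Unset Strict Implicit.
Unset Printing Implicit Defensive.

Import Order.TTheory GRing.Theory Num.Theory.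
Import numFieldNormedType.Exports.

Local Open Scope classical_set_scope.
Local Open Scope ring_scope.

(** * Tangent inequalities for the logarithm and for powers *)

(** The inequality [1 + y < expR y] at [y = ln (x / a)]. *)
Lemma ln_lt_tangent (R : realType) (a x : R) : 0 < a -> 0 < x -> x != a ->
  ln x < ln a + (x - a) / a.
Proof.
move=> a0 x0 xa.
have /expR_gt1Dx : ln (x / a) != 0.
  rewrite ln_eq0 ?divr_gt0//; apply: contra xa => /eqP xa1.
  by rewrite -[x](divfK (lt0r_neq0 a0)) xa1 mul1r.
rewrite lnK ?posrE ?divr_gt0// ln_div ?posrE// mulrBl divff ?gt_eqF//.
lra.
Qed.

(** Averaging the tangent inequality at the mean point cancels the linear terms. *)
Lemma ln_strictly_concave (R : realType) (x y t : R) : 0 < x -> 0 < y ->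
  x != y -> 0 < t -> t < 1 -> t * ln x + (1 - t) * ln y < ln (t * x + (1 - t) * y).
Proof.
move=> x0 y0 xy t0 t1; set m := _ + _ * y.
have m0 : 0 < m by rewrite addr_gt0// mulr_gt0// subr_gt0.
have xm : x - m = (1 - t) * (x - y) by rewrite /m; ring.
have ym : y - m = t * (y - x) by rewrite /m; ring.
have t1' : 0 < 1 - t by rewrite subr_gt0.
have hx : ln x < ln m + (x - m) / m.
  apply: ln_lt_tangent => //.
  by rewrite -subr_eq0 xm mulf_eq0 !subr_eq0 negb_or xy gt_eqF.
have hy : ln y < ln m + (y - m) / m.
  apply: ln_lt_tangent => //.
  by rewrite -subr_eq0 ym mulf_eq0 subr_eq0 negb_or (eq_sym y) xy gt_eqF.
have -> : ln m = t * (ln m + (x - m) / m) + (1 - t) * (ln m + (y - m) / m).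
  by rewrite xm ym; field; rewrite gt_eqF.
by rewrite ltrD// ltr_pM2l.
Qed.

(** A convex power lies strictly above its tangents (equivalently, Young's
    inequality with its equality case).  With [w = r * x - (r - 1) * a] the
    claim reads [a `^ (r - 1) * w < x `^ r].  Since [x] is the mean of [w] and
    [a] with weights [1 / r] and [1 - 1 / r], strict concavity of [ln] at these
    two points is the logarithm of the claim when [w > 0]. *)
Lemma powR_lt_tangent (R : realType) (r a x : R) : 1 < r -> 0 <= a -> 0 <= x ->
  x != a -> r * a `^ (r - 1) * x < (r - 1) * a `^ r + x `^ r.
Proof.
move=> r1 a0 x0 xa; have r0 : 0 < r by lra.
have r10 : 0 < r - 1 by lra.
move: a0; rewrite le_eqVlt => /predU1P[a0|a0].
  move: xa; rewrite -a0 !powR0 ?(lt0r_neq0 r10, lt0r_neq0 r0)// => xa.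
  by rewrite !(mulr0, mul0r) add0r powR_gt0// lt0r xa.
have aE : a `^ r = a * a `^ (r - 1) by rewrite mulr_powRB1// ltW.
have A0 := powR_gt0 (r - 1) a0.
set w := r * x - (r - 1) * a.
suff : a `^ (r - 1) * w < x `^ r by rewrite aE /w; nra.
(* A nonpositive [w] would have no logarithm, but then the claim compares signs. *)
have [w0|w0] := leP w 0.
  move: x0; rewrite le_eqVlt => /predU1P[x0|x0].
    rewrite -x0 powR0 ?gt_eqF// pmulr_rlt0// /w -x0; nra.
  by rewrite (le_lt_trans _ (powR_gt0 r x0))// pmulr_rle0.
have {}x0 : 0 < x.
  rewrite lt0r x0 andbT; apply: contraTN w0 => /eqP xz.
  rewrite /w xz -leNgt; nra.
rewrite -ltr_ln ?posrE ?powR_gt0 ?mulr_gt0 ?powR_gt0//.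
rewrite lnM ?posrE ?powR_gt0// !ln_powR.
have wa : w != a.
  rewrite -subr_eq0 (_ : w - a = r * (x - a)); last by rewrite /w; ring.
  by rewrite mulf_eq0 subr_eq0 negb_or xa gt_eqF.
have := @ln_strictly_concave R w a r^-1 w0 a0 wa.
rewrite invr_gt0 r0 invf_lt1// => /(_ erefl r1).
rewrite (_ : r^-1 * w + (1 - r^-1) * a = x); last first.
  by rewrite /w; field; rewrite gt_eqF.
rewrite -(ltr_pM2l r0) => /le_lt_trans; apply.
rewrite le_eqVlt; apply/orP; left; apply/eqP; field; rewrite gt_eqF//.
Qed.

Lemma powR_ge_tangent (R : realType) (r a x : R) : 1 < r -> 0 <= a -> 0 <= x ->
  r * a `^ (r - 1) * x <= (r - 1) * a `^ r + x `^ r.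
Proof.
move=> r1 a0 x0; have [->|xa] := eqVneq x a; last exact/ltW/powR_lt_tangent.
by rewrite -mulrA (mulrC _ a) mulr_powRB1//; lra.
Qed.

Lemma powRDE (R : realType) (x s t : R) : 0 < x -> x `^ (s + t) = x `^ s * x `^ t.
Proof. by move=> x0; rewrite powRD// (gt_eqF x0) implybT. Qed.

Lemma powRB1 (R : realType) (x q : R) : 0 < x -> x `^ (q - 1) = x `^ q / x.
Proof.
by move=> x0; rewrite powRB ?(gt_eqF x0) ?implybT// powRr1// ltW.
Qed.

Lemma powR_gap (R : realType) (q a b : R) : 0 < q -> 0 <= a -> a < b ->
  0 < b `^ q - a `^ q.
Proof.
by move=> q0 a0 ab; rewrite subr_gt0; apply: gt0_ltr_powR; rewrite ?nnegrE//; lra.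
Qed.

(** * Derivatives, monotonicity and convexity *)

(** Writing the derivative with [x `^ q / x] makes [x] and [x `^ q] the only
    atoms, so that [field] can compare derivatives. *)
Lemma is_derive_powR (R : realType) (x q : R) : 0 < x ->
  is_derive x 1 (fun t => t `^ q) (q * (x `^ q / x)).
Proof. by move=> x0; rewrite -powRB1//; exact: is_derive1_powR. Qed.

Lemma is_derive_quotient (R : realType) (f g : R -> R) (x df dg : R) :
  is_derive x 1 f df -> is_derive x 1 g dg -> g x != 0 ->
  is_derive x 1 (fun y => f y / g y) ((df * g x - f x * dg) / g x ^+ 2).
Proof.
move=> hf hg gx0; have hv := is_deriveV gx0 hg.
apply: (@is_derive_eq _ _ _ _ _ _ _ _ (is_deriveM hf hv)).
by rewrite /GRing.scale/=; field.
Qed.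

Lemma le_of_derive_ge0 (R : realType) (a b : R) (f f1 : R -> R) : a <= b ->
  (forall x, a <= x <= b -> is_derive x 1 f (f1 x)) ->
  (forall x, a < x < b -> 0 <= f1 x) -> f a <= f b.
Proof.
move=> ab df f10.
have cf : {within `[a, b], continuous f}.
  apply: derivable_within_continuous => z; rewrite in_itv/= => zab.
  by have [] := df _ zab.
move: ab; rewrite le_eqVlt => /predU1P[->//|ab].
have df' x : x \in `]a, b[ -> is_derive x 1 f (f1 x).
  by rewrite in_itv/= => xab; apply: df; lra.
have [c] := MVT ab df' cf.
rewrite in_itv/= => cab e; rewrite -subr_ge0 e mulr_ge0 ?f10//; lra.
Qed.

(** The form of the second derivative test used below: both derivatives are
    given explicitly on the open interval, so that nothing is asked at the end
    points, where the powers may fail to be differentiable. *)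
Lemma convex_of_second_derive (R : realType) (a b : R) (f f1 f2 : R -> R) :
  (forall x, a < x < b -> is_derive x 1 f (f1 x)) ->
  (forall x, a < x < b -> is_derive x 1 f1 (f2 x)) ->
  (forall x, a < x < b -> 0 <= f2 x) ->
  forall x y t, a < x < b -> a < y < b -> 0 < t -> t < 1 ->
  f (t * x + (1 - t) * y) <= t * f x + (1 - t) * f y.
Proof.
move=> df df1 f20 x y t.
wlog xy : x y t / x <= y => [H xab yab t0 t1|].
  have [xy|/ltW yx] := leP x y; first exact: H.
  have t0' : 0 < 1 - t by lra.
  have t1' : 1 - t < 1 by lra.
  have := H y x (1 - t) yx yab xab t0' t1'.
  rewrite (_ : 1 - (1 - t) = t); last by ring.
  by rewrite (addrC (_ * y)) (addrC (_ * f y)).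
move=> xab yab t0 t1.
have inab z : x <= z <= y -> a < z < b by move=> /andP[? ?]; lra.
have cf z : x <= z <= y -> {for z, continuous f}.
  by move=> /inab /df [+ _] => /derivable1_diffP/differentiable_continuous.
have D1 z : a < z < b -> 'D_1 f z = f1 z by move=> /df ?; rewrite derive_val.
have D1near z : a < z < b -> \forall w \near z, f1 w = 'D_1 f w.
  move=> zab; near=> w; rewrite D1//; apply/andP; split.
    near: w; apply: lt_nbhsr; lra.
  near: w; apply: lt_nbhsl; lra.
have dD1 z : a < z < b -> is_derive z 1 ('D_1 f) (f2 z).
  move=> zab; have [d1 e1] := df1 _ zab; split.
    by apply: near_eq_derivable d1; exact: D1near.
  by rewrite -e1; apply/esym/near_eq_derive; exact: D1near.
have := @second_derivative_convex R f x y _ _ _ _ _ (Itv01 (ltW t0) (ltW t1)) xy.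
rewrite /=; apply.
- move=> z zxy; have zab : a < z < b by lra.
  by rewrite (@derive_val _ _ _ _ _ _ _ (dD1 _ zab)) f20.
- apply: cvg_at_left_filter; apply: cf; lra.
- apply: cvg_at_right_filter; apply: cf; lra.
- move=> z; rewrite in_itv/= => zxy; have zab : a < z < b by lra.
  by have [] := df _ zab.
- move=> z; rewrite in_itv/= => zxy; have zab : a < z < b by lra.
  by have [] := dD1 _ zab.
Unshelve. all: by end_near. Qed.

(** * Log-concavity under subtraction of a constant *)

Lemma weighted_AGM (R : realType) (a b t : R) : 0 < a -> 0 < b -> 0 < t -> t < 1 ->
  expR (t * ln a + (1 - t) * ln b) <= t * a + (1 - t) * b.
Proof.
move=> a0 b0 t0 t1; have [<-|ab] := eqVneq a b.
  by rewrite -!mulrDl subrKC !mul1r lnK.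
have m0 : 0 < t * a + (1 - t) * b by nra.
by rewrite -[leRHS]lnK// ler_expR ltW// ln_strictly_concave.
Qed.

(** Log-concavity survives the subtraction of a constant [c >= 0]: the map
    [v |-> ln (expR v - c)] is nondecreasing and concave.  Concavity is the
    superadditivity of the weighted geometric mean, obtained by adding two
    instances of the inequality of means, for the ratios [(A - c) / A],
    [(B - c) / B] and for the ratios [c / A], [c / B]. *)
Lemma ln_concave_subr (R : realType) (A B M c t : R) : 0 <= c -> c < A -> c < B ->
  0 < M -> 0 < t -> t < 1 -> t * ln A + (1 - t) * ln B <= ln M ->
  t * ln (A - c) + (1 - t) * ln (B - c) <= ln (M - c).
Proof.
rewrite le_eqVlt => /predU1P[<-|c0] cA cB M0 t0 t1; first by rewrite !subr0.
have A0 : 0 < A by lra. have B0 : 0 < B by lra.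
have Ac0 : 0 < A - c by lra. have Bc0 : 0 < B - c by lra.
rewrite -ler_expR (lnK M0); set G := expR _; set v := (leLHS in _ -> leLHS <= _).
move=> GM.
suff HG : expR v + c <= G.
  have Mc0 : 0 < M - c by have := expR_gt0 v; lra.
  by rewrite -ler_expR lnK//; lra.
have G0 : 0 < G by exact: expR_gt0.
have e1 : expR v / G = expR (t * ln ((A - c) / A) + (1 - t) * ln ((B - c) / B)).
  by rewrite -expRB !ln_div//; congr expR; rewrite /v; ring.
have h1 := @weighted_AGM R ((A - c) / A) ((B - c) / B) t.
rewrite !divr_gt0// -e1 in h1; have {}h1 := h1 erefl erefl t0 t1.
have e2 : c / G = expR (t * ln (c / A) + (1 - t) * ln (c / B)).
  rewrite !ln_div// -{1}(lnK c0) -expRB; congr expR; rewrite /v; ring.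
have h2 := @weighted_AGM R (c / A) (c / B) t.
rewrite !divr_gt0// -e2 in h2; have {}h2 := h2 erefl erefl t0 t1.
rewrite -[leRHS]mul1r -ler_pdivrMr// mulrDl (le_trans (lerD h1 h2))//.
rewrite le_eqVlt; apply/orP; left; apply/eqP; field; rewrite !gt_eqF//.
Qed.

(** * Two functions built from the chord slope of a power *)

(** Up to a positive factor this is the second derivative of
    [secant_reciprocal q l].  It vanishes at [l], and its derivative in [x] is
    [q + 1] times the gap between [l `^ q] and the value at [l] of the tangent
    at [x] to the power [q]. *)
Lemma secant_kernel_ge0 (R : realType) (q l x : R) : 1 < q -> 0 <= l -> l <= x ->
  0 <= (q - 1) * x `^ (q + 1) - (q + 1) * l * x `^ q +
       (q + 1) * l `^ q * x - (q - 1) * l `^ (q + 1).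
Proof.
move=> q1; rewrite le_eqVlt => /predU1P[<-|l0] lx.
  rewrite !powR0 ?gt_eqF; try lra.
  have := powR_ge0 x (q + 1); nra.
pose f := fun x : R => (q - 1) * x `^ (q + 1) - (q + 1) * l * x `^ q +
       (q + 1) * l `^ q * x - (q - 1) * l `^ (q + 1).
have fl : f l = 0.
  rewrite /f -(@mulr_powRB1 _ l (q + 1)) ?addrK; first ring; lra.
rewrite -fl -/(f x).
apply: (@le_of_derive_ge0 _ _ _ f (fun x => (q + 1) *
  ((q - 1) * x `^ q - q * x `^ (q - 1) * l + l `^ q)) lx) => z zlx.
  have z0 : 0 < z by lra.
  have dq := is_derive1_powR q z0; have dq1 := is_derive1_powR (q + 1) z0.
  rewrite /f; apply: is_derive_eq; rewrite /GRing.scale/= addrK; ring.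
have z0 : 0 <= z by lra.
have := powR_ge_tangent q1 z0 (ltW l0); nra.
Qed.

(** The reciprocal of the slope of the chord of [t |-> t `^ q] between [l] and [z]. *)
Definition secant_reciprocal (R : realType) (q l z : R) : R :=
  (z - l) / (z `^ q - l `^ q).

Lemma convex_secant_reciprocal (R : realType) (q l u x y t : R) : 1 < q -> 0 <= l ->
  l < x < u -> l < y < u -> 0 < t -> t < 1 ->
  secant_reciprocal q l (t * x + (1 - t) * y) <=
  t * secant_reciprocal q l x + (1 - t) * secant_reciprocal q l y.
Proof.
move=> q1 l0 xlu ylu t0 t1; set k := secant_reciprocal q l.
set L := l `^ q.
(* [k1] and [k2] are the first two derivatives of [k]; the sign of [k2] is that
   of [phi]. *)
pose k1 z := (z `^ q - L - (z - l) * (q * (z `^ q / z))) / (z `^ q - L) ^+ 2.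
pose phi z := (q - 1) * (z * z `^ q) - (q + 1) * l * z `^ q +
             (q + 1) * L * z - (q - 1) * (l * L).
pose k2 z := q * (z `^ q / z ^+ 2) * phi z / (z `^ q - L) ^+ 3.
apply: (@convex_of_second_derive _ l u k k1 k2 _ _ _ x y t _ _ t0 t1);
  [move=> z /andP[lz zu]..|exact: xlu|exact: ylu].
- have z0 : 0 < z by lra.
  have D0 : z `^ q - L != 0 by rewrite gt_eqF// powR_gap//; lra.
  have dq := is_derive_powR q z0.
  have dD : is_derive z 1 (fun z => z `^ q - L) (q * (z `^ q / z)).
    by apply: is_derive_eq; rewrite subr0.
  have dN : is_derive z 1 (fun z : R => z - l) 1.
    by apply: is_derive_eq; rewrite subr0.
  rewrite /k /secant_reciprocal.
  apply: (@is_derive_eq _ _ _ _ _ _ _ _ (is_derive_quotient dN dD D0)).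
  by rewrite /k1 mul1r.
- have z0 : 0 < z by lra.
  have D0 : z `^ q - L != 0 by rewrite gt_eqF// powR_gap//; lra.
  have dq := is_derive_powR q z0.
  have dD : is_derive z 1 (fun z => z `^ q - L) (q * (z `^ q / z)).
    by apply: is_derive_eq; rewrite subr0.
  have dD2 : is_derive z 1 (fun z => (z `^ q - L) ^+ 2)
      (2 * (z `^ q - L) * (q * (z `^ q / z))).
    by apply: is_derive_eq; rewrite /GRing.scale/=; ring.
  have did : is_derive z 1 (fun z : R => z) 1 by exact: is_derive_id.
  have dX : is_derive z 1 (fun z : R => z `^ q / z) _ :=
    is_derive_quotient dq did (lt0r_neq0 z0).
  have dN : is_derive z 1 (fun z : R => z `^ q - L - (z - l) * (q * (z `^ q / z)))
      (- ((z - l) * (q * (q - 1) * (z `^ q / z ^+ 2)))).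
    by apply: is_derive_eq; rewrite /GRing.scale/=; field; rewrite gt_eqF.
  have D20 : (z `^ q - L) ^+ 2 != 0 by rewrite expf_neq0.
  rewrite /k1.
  apply: (@is_derive_eq _ _ _ _ _ _ _ _ (is_derive_quotient dN dD2 D20)).
  rewrite /k2 /phi; field; rewrite D0 gt_eqF//.
- have z0 : 0 < z by lra.
  have D0 : 0 < z `^ q - L by rewrite powR_gap//; lra.
  rewrite /k2 divr_ge0 ?exprn_ge0 ?(ltW D0)// mulr_ge0//.
    by rewrite mulr_ge0 ?divr_ge0 ?powR_ge0 ?exprn_ge0//; lra.
  have := secant_kernel_ge0 q1 l0 (ltW lz).
  by rewrite -!(@mulr_powRB1 _ _ (q + 1)) ?addrK//; lra.
Qed.

(** With [q = 2 * s + 1] this says that the chord slope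
    [(u `^ q - z `^ q) / (u - z)] is at least [q * (z * u) `^ s], the geometric
    mean of the end derivatives; it is [sinh (q * v) >= q * sinh v] in disguise.
    The difference of the two sides vanishes at [z = u], and its derivative in
    [z] is minus a positive multiple of a tangent gap for the exponent [s + 1]. *)
Lemma powR_gap_ge_geometric (R : realType) (s z u : R) : 0 < s -> 0 < z -> z <= u ->
  (2 * s + 1) * (z `^ s * u `^ s) * (u - z) <= u * u `^ s ^+ 2 - z * z `^ s ^+ 2.
Proof.
move=> s0 z0 zu; have u0 : 0 < u by lra.
set b := u `^ s.
(* [f x] exceeds [x * x `^ s ^+ 2] by the left-hand side with [x] for [z]. *)
pose f := fun x : R => x `^ (2 * s + 1) + (2 * s + 1) * b * (u * x `^ s - x `^ (s + 1)).
have fE x : 0 < x -> f x = x * x `^ s ^+ 2 + (2 * s + 1) * (x `^ s * b) * (u - x).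
  move=> x0; rewrite /f (_ : 2 * s + 1 = s + s + 1); last by ring.
  by rewrite !powRDE// powRr1 ?ltW//; ring.
have fu : f u = u * b ^+ 2 by rewrite fE// /b; ring.
suff : f z <= f u by rewrite fu fE//; lra.
apply: (@le_of_derive_ge0 _ _ _ _ (fun x => (2 * s + 1) * (x `^ s / x) *
  (x `^ (s + 1) + s * u `^ (s + 1) - (s + 1) * b * x))) => //.
  move=> x /andP[zx xu]; have x0 : 0 < x by lra.
  have d1 := is_derive_powR (2 * s + 1) x0; have d2 := is_derive_powR s x0.
  have d3 := is_derive_powR (s + 1) x0.
  rewrite /f; apply: is_derive_eq; rewrite /GRing.scale/=.
  rewrite (_ : 2 * s + 1 = s + s + 1); last by ring.
  rewrite !powRDE// !powRr1 ?ltW//; rewrite -/b; field.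
  by rewrite gt_eqF.
move=> x /andP[zx xu]; have x0 : 0 < x by lra.
apply: mulr_ge0; first by rewrite mulr_ge0 ?divr_ge0 ?powR_ge0 ?(ltW x0)//; lra.
have s1 : 1 < s + 1 by lra.
have := powR_ge_tangent s1 (ltW u0) (ltW x0); rewrite addrK -/b; lra.
Qed.

Definition weighted_secant_reciprocal (R : realType) (q u z : R) : R :=
  z `^ q * (u - z) / (u `^ q - z `^ q).

(** With [X = z `^ q] and [U = u `^ q], the second derivative of minus this
    logarithm has the sign of
    [z ^+ 2 * (U - X) ^+ 2 - q * U * ((q + 1) * X - U) * (u - z) ^+ 2].
    The geometric lower bound on [U - X] reduces its nonnegativity to
    [(q + 1) * u * X <= q * X * z + U * u], the tangent inequality for the
    exponent [q + 1]. *)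
Lemma ln_weighted_secant_reciprocal_concave (R : realType) (q u x y t : R) : 1 < q ->
  0 < x < u -> 0 < y < u -> 0 < t -> t < 1 ->
  t * ln (weighted_secant_reciprocal q u x) +
  (1 - t) * ln (weighted_secant_reciprocal q u y) <=
  ln (weighted_secant_reciprocal q u (t * x + (1 - t) * y)).
Proof.
move=> q1 xu yu t0 t1.
have xyu : 0 < t * x + (1 - t) * y < u by nra.
set U := u `^ q.
pose f z := ln (U - z `^ q) - ln (u - z) - q * ln z.
have fE z : 0 < z < u -> ln (weighted_secant_reciprocal q u z) = - f z.
  move=> /andP[z0 zu]; rewrite /weighted_secant_reciprocal /f.
  rewrite ln_div ?posrE ?powR_gap ?mulr_gt0 ?powR_gt0//; try lra.
  rewrite lnM ?posrE ?powR_gt0//; try lra.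
  by rewrite ln_powR -/U; ring.
rewrite !fE//.
(* [f1] and [f2] are the first two derivatives of [f]. *)
pose f1 z := - (q * (z `^ q / z) / (U - z `^ q)) + (u - z)^-1 - q / z.
pose f2 z := - ((q * (q - 1) * (z `^ q / z ^+ 2) * (U - z `^ q) +
    (q * (z `^ q / z)) ^+ 2) / (U - z `^ q) ^+ 2) + (u - z) ^- 2 + q / z ^+ 2.
suff : f (t * x + (1 - t) * y) <= t * f x + (1 - t) * f y by lra.
apply: (@convex_of_second_derive _ 0 u f f1 f2 _ _ _ x y t _ _ t0 t1);
  [move=> z /andP[z0 zu]..|exact: xu|exact: yu].
- have D0 : 0 < U - z `^ q by rewrite powR_gap//; lra.
  have u0 : 0 < u - z by lra.
  have dq := is_derive_powR q z0.
  have dD : is_derive z 1 (fun z => U - z `^ q) (- (q * (z `^ q / z))).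
    by apply: is_derive_eq; ring.
  have du : is_derive z 1 (fun z : R => u - z) (-1).
    by apply: is_derive_eq; ring.
  have dlD := @is_derive1_comp R (@ln R) (fun z => U - z `^ q) _ _ _
    (is_derive1_ln D0) dD.
  have dlu := @is_derive1_comp R (@ln R) (fun z => u - z) _ _ _
    (is_derive1_ln u0) du.
  have dl := is_derive1_ln z0.
  rewrite /comp in dlD dlu.
  rewrite /f; apply: is_derive_eq.
  rewrite /f1 /GRing.scale/=; field; rewrite !gt_eqF//.
- have D0 : 0 < U - z `^ q by rewrite powR_gap//; lra.
  have u0 : 0 < u - z by lra.
  have dq := is_derive_powR q z0.
  have did : is_derive z 1 (fun z : R => z) 1 by exact: is_derive_id.
  have dX : is_derive z 1 (fun z : R => z `^ q / z) _ :=
    is_derive_quotient dq did (lt0r_neq0 z0).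
  have dqX : is_derive z 1 (fun z : R => q * (z `^ q / z))
      (q * (q - 1) * (z `^ q / z ^+ 2)).
    by apply: is_derive_eq; rewrite /GRing.scale/=; field; rewrite gt_eqF.
  have dD : is_derive z 1 (fun z => U - z `^ q) (- (q * (z `^ q / z))).
    by apply: is_derive_eq; ring.
  have du : is_derive z 1 (fun z : R => u - z) (-1).
    by apply: is_derive_eq; ring.
  have d1 := is_derive_quotient dqX dD (lt0r_neq0 D0).
  have d2 := @is_deriveV R (fun z => u - z) _ _ _ (lt0r_neq0 u0) du.
  have d3 := @is_deriveV R (fun z => z) _ _ _ (lt0r_neq0 z0) did.
  rewrite /f1; apply: is_derive_eq.
  rewrite /f2 /GRing.scale/=; field; rewrite !gt_eqF//.
- have D0 : 0 < U - z `^ q by rewrite powR_gap//; lra.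
  have u0 : 0 < u - z by lra.
  set X := z `^ q in D0 *.
  have u00 : 0 < u by lra.
  have s0 : 0 < (q - 1) / 2 by lra.
  have := powR_gap_ge_geometric s0 z0 (ltW zu).
  set a := z `^ _; set b := u `^ _ => hgeo.
  have XE : X = z * a ^+ 2.
    rewrite /X /a expr2 -!powRDE// (_ : _ / 2 + _ / 2 = q - 1); last by field.
    by rewrite mulr_powRB1//; lra.
  have UE : U = u * b ^+ 2.
    rewrite /U /b expr2 -!powRDE// (_ : _ / 2 + _ / 2 = q - 1); last by field.
    by rewrite mulr_powRB1//; lra.
  have a0 : 0 < a by exact: powR_gt0.
  have b0 : 0 < b by exact: powR_gt0.
  (* The tangent at [z] to the power [q + 1], evaluated at [u]. *)
  have hyoung : (q + 1) * u * X <= q * X * z + U * u.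
    have q2 : 1 < q + 1 by lra.
    have := powR_ge_tangent q2 (ltW z0) (ltW u00).
    rewrite addrK -/X -!(@mulr_powRB1 _ _ (q + 1)) ?addrK -/X -/U; lra.
  (* The square of the geometric bound [hgeo], cleared of denominators. *)
  have hsq : q ^+ 2 * X * U * (u - z) ^+ 2 <= (U - X) ^+ 2 * (z * u).
    have : (q * (a * b) * (u - z)) ^+ 2 <= (U - X) ^+ 2.
      rewrite lerXn2r ?nnegrE ?(ltW D0)//.
        by rewrite !mulr_ge0 ?(ltW u0) ?(ltW a0) ?(ltW b0)//; lra.
      by move: hgeo; rewrite -XE -UE; lra.
    have zu0 : 0 < z * u by rewrite mulr_gt0.
    move=> h; apply: le_trans (ler_wpM2r (ltW zu0) h).
    rewrite XE UE; lra.
  have hnum : 0 <= z ^+ 2 * (U - X) ^+ 2 - q * U * ((q + 1) * X - U) * (u - z) ^+ 2.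
    have h1 := ler_wpM2l (ltW z0) hsq.
    have h2 : 0 <= q * U * (u - z) ^+ 2 * (q * X * z + U * u - (q + 1) * u * X).
      rewrite mulr_ge0 ?subr_ge0// !mulr_ge0 ?sqr_ge0 ?powR_ge0//; lra.
    rewrite -(pmulr_rge0 _ u00); lra.
  have -> : f2 z = (z ^+ 2 * (U - X) ^+ 2 - q * U * ((q + 1) * X - U) * (u - z) ^+ 2)
      / (z ^+ 2 * (U - X) ^+ 2 * (u - z) ^+ 2).
    rewrite /f2 -/X; field; rewrite !gt_eqF//.
  by apply: divr_ge0 => //; apply: mulr_ge0; [apply: mulr_ge0|]; exact: sqr_ge0.
Qed.

(** * Tangents of the power function *)

Definition intercept (R : realType) (p a : R) : R := a `^ p - pow_diff p a * a.

Lemma tangent_lt_powR (R : realType) (p a x : R) : 1 < p -> 0 <= a -> 0 <= x ->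
  x != a -> pow_diff p a * x + intercept p a < x `^ p.
Proof.
move=> p1 a0 x0 xa; have := powR_lt_tangent p1 a0 x0 xa.
rewrite /intercept /pow_diff; have p0 : 0 < p by lra.
have := mulr_powRB1 a0 p0; nra.
Qed.

Lemma tangent_touch (R : realType) (p a : R) :
  pow_diff p a * a + intercept p a = a `^ p.
Proof. by rewrite /intercept; ring. Qed.

Lemma tangent_lt (R : realType) (p a x : R) : 1 < p -> 0 <= a -> 0 <= x ->
  x != a -> pow_diff p a * x + intercept p a < pow_diff p x * x + intercept p x.
Proof. by rewrite tangent_touch; exact: tangent_lt_powR. Qed.

Lemma pow_diff_lt (R : realType) (p a b : R) : 1 < p -> 0 <= a -> a < b ->
  pow_diff p a < pow_diff p b.
Proof.
move=> p1 a0 ab; rewrite /pow_diff ltr_pM2l; last by lra.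
by rewrite -subr_gt0 powR_gap//; lra.
Qed.

Lemma tangent_meetP (R : realType) (p a b : R) : 1 < p -> 0 <= a -> a < b ->
  pow_diff p a * tangent_meet p a b + intercept p a =
  pow_diff p b * tangent_meet p a b + intercept p b.
Proof.
move=> p1 a0 ab; have d := pow_diff_lt p1 a0 ab.
by rewrite /tangent_meet /intercept; field; rewrite subr_eq0 lt_eqF.
Qed.

Lemma tangent_meet_between (R : realType) (p a b : R) : 1 < p -> 0 <= a -> a < b ->
  a < tangent_meet p a b < b.
Proof.
move=> p1 a0 ab; have d := pow_diff_lt p1 a0 ab.
have h := tangent_meetP p1 a0 ab.
have b0 : 0 <= b by lra.
have h1 := tangent_lt p1 a0 b0 (negbT (gt_eqF ab)).
have h2 := tangent_lt p1 b0 a0 (negbT (lt_eqF ab)).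
set m := tangent_meet _ _ _ in h *.
have d0 : 0 < pow_diff p b - pow_diff p a by lra.
rewrite -(ltr_pM2l d0) -[X in _ && X](ltr_pM2l d0); lra.
Qed.

(** The tangent at [c] is below that at [b] to the left of [b], in particular
    at the point where the latter meets the tangent at [a]. *)
Lemma tangent_meet_ltr (R : realType) (p a b c : R) : 1 < p -> 0 <= a -> a < b ->
  b < c -> tangent_meet p a b < tangent_meet p a c.
Proof.
move=> p1 a0 ab bc.
have ac : a < c by lra. have b0 : 0 <= b by lra. have c0 : 0 <= c by lra.
have dac := pow_diff_lt p1 a0 ac; have dbc := pow_diff_lt p1 b0 bc.
have /andP[_ tb] := tangent_meet_between p1 a0 ab.
have hab := tangent_meetP p1 a0 ab; have hac := tangent_meetP p1 a0 ac.
have hb := tangent_lt p1 c0 b0 (negbT (lt_eqF bc)).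
have d0 : 0 < pow_diff p c - pow_diff p a by lra.
rewrite -(ltr_pM2l d0).
have : 0 < (pow_diff p c - pow_diff p b) * (b - tangent_meet p a b).
  by rewrite mulr_gt0//; lra.
lra.
Qed.

Lemma tangent_meet_ltl (R : realType) (p a b c : R) : 1 < p -> 0 <= a -> a < b ->
  b < c -> tangent_meet p a c < tangent_meet p b c.
Proof.
move=> p1 a0 ab bc.
have ac : a < c by lra. have b0 : 0 <= b by lra. have c0 : 0 <= c by lra.
have dac := pow_diff_lt p1 a0 ac; have dab := pow_diff_lt p1 a0 ab.
have /andP[bt _] := tangent_meet_between p1 b0 bc.
have hbc := tangent_meetP p1 b0 bc; have hac := tangent_meetP p1 a0 ac.
have hb := tangent_lt p1 a0 b0 (negbT (gt_eqF ab)).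
have d0 : 0 < pow_diff p c - pow_diff p a by lra.
rewrite -(ltr_pM2l d0).
have : 0 < (pow_diff p b - pow_diff p a) * (tangent_meet p b c - b).
  by rewrite mulr_gt0//; lra.
lra.
Qed.

(** For a fixed left contact point the abscissa is an affine function of the
    right contact point plus a multiple of a convex function of it. *)
Lemma tangent_meet_secant (R : realType) (p l x : R) : 1 < p -> 0 <= l -> l < x ->
  tangent_meet p l x =
  (p - 1) / p * (x + l `^ (p - 1) * secant_reciprocal (p - 1) l x).
Proof.
move=> p1 l0 lx; have p0 : 0 < p by lra. have x0 : 0 <= x by lra.
have p10 : 0 < p - 1 by lra.
have := powR_gap p10 l0 lx.
rewrite /tangent_meet /pow_diff /secant_reciprocal -!(@mulr_powRB1 _ _ p)// => g.
field; rewrite (gt_eqF g) (gt_eqF p0) -mulrBr mulf_neq0 ?(gt_eqF p0)//.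
by rewrite lt_eqF// -oppr_gt0 opprB.
Qed.

(** For a fixed right contact point the abscissa is a constant plus a positive
    multiple of a log-concave function of the left contact point. *)
Lemma tangent_meet_weighted (R : realType) (p x u : R) : 1 < p -> 0 <= x -> x < u ->
  tangent_meet p x u = (p - 1) / p * (u + weighted_secant_reciprocal (p - 1) u x).
Proof.
move=> p1 x0 xu; have p0 : 0 < p by lra. have u0 : 0 <= u by lra.
have p10 : 0 < p - 1 by lra.
have := powR_gap p10 x0 xu.
rewrite /tangent_meet /pow_diff /weighted_secant_reciprocal.
rewrite -!(@mulr_powRB1 _ _ p)// => g.
field; rewrite (gt_eqF g) (gt_eqF p0) -mulrBr mulf_neq0 ?(gt_eqF p0)//.
by rewrite lt_eqF// -oppr_gt0 opprB.
Qed.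

(** The gap is a concave function of the contact point, since the abscissa is
    convex.  Strictness comes from [ln]: the gap takes distinct values at [x]
    and [y] because the abscissa is strictly increasing. *)
Lemma ln_left_gap_strictly_concave (R : realType) (p l u x y t : R) : 2 < p ->
  0 <= l -> l < x < u -> l < y < u -> x != y -> 0 < t -> t < 1 ->
  t * ln (tangent_meet p l u - tangent_meet p l x) +
  (1 - t) * ln (tangent_meet p l u - tangent_meet p l y) <
  ln (tangent_meet p l u - tangent_meet p l (t * x + (1 - t) * y)).
Proof.
move=> p2 l0 xlu ylu xy t0 t1.
have p1 : 1 < p by lra. have q1 : 1 < p - 1 by lra.
have mlu : l < t * x + (1 - t) * y < u by nra.
have pos z : l < z < u -> 0 < tangent_meet p l u - tangent_meet p l z.
  by move=> /andP[lz zu]; rewrite subr_gt0 tangent_meet_ltr.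
have neq : tangent_meet p l u - tangent_meet p l x !=
    tangent_meet p l u - tangent_meet p l y.
  rewrite (inj_eq (addrI _)) eqr_opp.
  move: xlu ylu => /andP[lx _] /andP[ly _].
  case: ltgtP xy => // xy _.
    by rewrite lt_eqF// tangent_meet_ltr.
  by rewrite gt_eqF// tangent_meet_ltr.
apply: lt_le_trans (ln_strictly_concave (pos _ xlu) (pos _ ylu) neq t0 t1) _.
have conv : tangent_meet p l (t * x + (1 - t) * y) <=
    t * tangent_meet p l x + (1 - t) * tangent_meet p l y.
  move: (xlu) (ylu) (mlu) => /andP[lx _] /andP[ly _] /andP[lm _].
  rewrite !tangent_meet_secant//.
  have h := convex_secant_reciprocal q1 l0 xlu ylu t0 t1.
  have c0 : 0 <= (p - 1) / p by rewrite divr_ge0//; lra.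
  have := ler_wpM2l c0 (ler_wpM2l (powR_ge0 l (p - 1)) h).
  set c := (p - 1) / p; set L := l `^ _; lra.
have px := mulr_gt0 t0 (pos _ xlu).
have py : 0 < (1 - t) * (tangent_meet p l u - tangent_meet p l y).
  by rewrite mulr_gt0 ?pos// subr_gt0.
by rewrite ler_ln ?posrE ?pos// ?addr_gt0//; lra.
Qed.

(** This gap is in general not concave.  It is a positive multiple of [W x - W l]
    for [W = weighted_secant_reciprocal (p - 1) u], which is log-concave, and
    [W l >= 0]; so [ln_concave_subr] applies. *)
Lemma ln_right_gap_concave (R : realType) (p l u x y t : R) : 2 < p ->
  0 <= l -> l < x < u -> l < y < u -> 0 < t -> t < 1 ->
  t * ln (tangent_meet p x u - tangent_meet p l u) +
  (1 - t) * ln (tangent_meet p y u - tangent_meet p l u) <=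
  ln (tangent_meet p (t * x + (1 - t) * y) u - tangent_meet p l u).
Proof.
move=> p2 l0 xlu ylu t0 t1.
have p1 : 1 < p by lra. have q1 : 1 < p - 1 by lra. have lu : l < u by lra.
have mlu : l < t * x + (1 - t) * y < u by nra.
set c := (p - 1) / p; have c0 : 0 < c by rewrite divr_gt0//; lra.
set K := weighted_secant_reciprocal (p - 1) u l.
have K0 : 0 <= K.
  apply: divr_ge0; first by rewrite mulr_ge0 ?powR_ge0//; lra.
  by rewrite ltW// powR_gap//; lra.
have KW z : l < z < u -> K < weighted_secant_reciprocal (p - 1) u z.
  move=> /andP[lz zu]; have z0 : 0 <= z by lra.
  have := tangent_meet_ltl p1 l0 lz zu.
  by rewrite !tangent_meet_weighted// ltr_pM2l// ltrD2l.
have gapE z : l < z < u -> ln (tangent_meet p z u - tangent_meet p l u) =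
    ln c + ln (weighted_secant_reciprocal (p - 1) u z - K).
  move=> /[dup] /KW Kz /andP[lz zu]; have z0 : 0 <= z by lra.
  rewrite !tangent_meet_weighted// -lnM ?posrE ?subr_gt0// -/K -/c; congr ln; ring.
rewrite !gapE//.
have x0u : 0 < x < u by lra. have y0u : 0 < y < u by lra.
have M0 : 0 < weighted_secant_reciprocal (p - 1) u (t * x + (1 - t) * y).
  by have := KW _ mlu; lra.
have := ln_concave_subr K0 (KW _ xlu) (KW _ ylu) M0 t0 t1
  (ln_weighted_secant_reciprocal_concave q1 x0u y0u t0 t1).
lra.
Qed.

(** * Integrals and volumes by slices *)

Local Notation mu := lebesgue_measure.

Lemma integral_of_antiderivative (R : realType) (a b : R) (F f : R -> R) : a <= b ->
  (forall x : R, is_derive x 1 F (f x)) -> continuous f ->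
  (\int[mu]_(x in `[a, b]) (f x)%:E = (F b - F a)%:E)%E.
Proof.
move=> ab dF cf; move: ab; rewrite le_eqVlt => /predU1P[<-|ab].
  by rewrite set_itv1 integral_set1 subrr.
have cF x : {for x, continuous F}.
  by have [+ _] := dF x => /derivable1_diffP/differentiable_continuous.
rewrite (@continuous_FTC2 _ f F)//.
- exact: continuous_subspaceT.
- split; first by move=> x _; have [] := dF x.
    exact/cvg_at_right_filter/cF.
  exact/cvg_at_left_filter/cF.
- by move=> x _; rewrite derive1E derive_val.
Qed.

Lemma integral_affine (R : realType) (a b c d : R) : a <= b ->
  (\int[mu]_(x in `[a, b]) (c * x + d)%:E =
   ((b - a) * (c * (a + b) / 2 + d))%:E)%E.
Proof.
move=> ab.
have dF (x : R) : is_derive x 1 (fun x => c / 2 * x ^+ 2 + d * x) (c * x + d).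
  by apply: is_derive_eq; rewrite /GRing.scale/=; field.
have cf : continuous (fun x : R => c * x + d).
  by move=> x; apply: cvgD; [apply: cvgMr|apply: cvg_cst].
by rewrite (integral_of_antiderivative ab dF cf); congr EFin; field.
Qed.

Lemma integral_sqr01 (R : realType) (c : R) :
  (\int[mu]_(z in `[0%R, 1%R]) (c * z ^+ 2)%:E = (c / 3)%:E)%E.
Proof.
have dF (z : R) : is_derive z 1 (fun z => c / 3 * z ^+ 3) (c * z ^+ 2).
  by apply: is_derive_eq; rewrite /GRing.scale/=; field.
have cf : continuous (fun z : R => c * z ^+ 2).
  by move=> x; apply: cvgMr; exact: exprn_continuous.
by rewrite (integral_of_antiderivative ler01 dF cf); congr EFin; field.
Qed.

Lemma ge0_integral_itv_split (R : realType) (a b c : R) (f : R -> R) :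
  a <= b -> b <= c -> measurable_fun setT f ->
  (forall x, a <= x <= c -> 0 <= f x) ->
  (\int[mu]_(x in `[a, c]) (f x)%:E =
   \int[mu]_(x in `[a, b]) (f x)%:E + \int[mu]_(x in `[b, c]) (f x)%:E)%E.
Proof.
move=> ab bc mf f0.
have mE (A : set R) : measurable_fun A (EFin \o f).
  by apply/measurable_EFinP; exact: measurable_funTS.
rewrite -[in X in (_ = _ + X)%E]integral_itv_obnd_cbnd; last exact: mE.
have -> : `[a, c]%classic = `[a, b]%classic `|` `]b, c]%classic.
  by rewrite -itv_bndbnd_setU// bnd_simp.
rewrite ge0_integral_setU//.
- exact: mE.
- move=> x; rewrite -itv_bndbnd_setU ?bnd_simp//= in_itv/= => xac.
  by rewrite lee_fin f0.
- apply/disj_setPS => y [/=]; rewrite !in_itv/= => /andP[_ yb] /andP[].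
  by rewrite ltNge yb.
Qed.

(** Fubini for a region between two graphs; the product measure is by definition
    the integral of the lengths of the vertical sections. *)
Lemma measure_between_graphs (R : realType) (a b : R) (F G : R -> R) (S : set (R * R)) :
  (forall x, a <= x <= b -> F x <= G x) ->
  (forall x y, S (x, y) <-> a <= x <= b /\ F x <= y <= G x) ->
  ((mu \x mu) S = \int[mu]_(x in `[a, b]) (G x - F x)%:E)%E.
Proof.
move=> FG SE; rewrite [LHS]/product_measure1 [RHS]integral_mkcond.
apply: eq_integral => x _ /=; rewrite patchE mem_setE in_itv/=.
case: ifPn => xab.
  have -> : xsection S x = `[F x, G x]%classic.
    apply/seteqP; split => y; rewrite /xsection/= inE in_itv/= SE; first by case.
    by split.
  rewrite lebesgue_measure_itv/= lte_fin; case: ltP => // GF.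
  have -> : G x = F x by apply/eqP; rewrite eq_le GF FG.
  by rewrite subrr.
rewrite (_ : xsection S x = set0) ?measure0//.
apply/seteqP; split => y//; rewrite /xsection/= inE SE => -[xab'].
by rewrite xab' in xab.
Qed.

(** On a product canonical inference finds the structure that presupposes finite
    factors, so the one for sigma-finite factors is passed explicitly. *)
Definition sigma_finite_product d1 d2 (T1 : measurableType d1) (T2 : measurableType d2)
    (R : realType) (m1 : {sigma_finite_measure set T1 -> \bar R})
    (m2 : {sigma_finite_measure set T2 -> \bar R}) :
    {sigma_finite_measure set (T1 * T2)%type -> \bar R} :=
  HB.pack_for {sigma_finite_measure set (T1 * T2)%type -> \bar R} (m1 \x m2)%E
    (lebesgue_integral_fubini.measure_function_Measure_isSigmaFinite__to__measure_function_isSFinite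
      m1 m2)
    (lebesgue_integral_fubini.measure_function_Measure_isSigmaFinite__to__measure_function_isSigmaFinite
      m1 m2).

(** Cavalieri along the last coordinate, by uniqueness of the product measure. *)
Lemma product_measure1_ysection d1 d2 (T1 : measurableType d1) (T2 : measurableType d2)
    (R : realType) (m1 : {sigma_finite_measure set T1 -> \bar R})
    (m2 : {sigma_finite_measure set T2 -> \bar R}) (A : set (T1 * T2)) :
  measurable A -> ((m1 \x m2) A = \int[m2]_z m1 (ysection A z))%E.
Proof.
move=> mA; transitivity ((m1 \x^ m2)%E A); last by [].
by apply: product_measure_unique => // *; exact: product_measure2E.
Qed.

Lemma product_measure1_ysection_iter d1 d2 d3
    (T1 : measurableType d1) (T2 : measurableType d2) (T3 : measurableType d3)
    (R : realType) (m1 : {sigma_finite_measure set T1 -> \bar R})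
    (m2 : {sigma_finite_measure set T2 -> \bar R})
    (m3 : {sigma_finite_measure set T3 -> \bar R}) (A : set (T1 * T2 * T3)) :
  measurable A -> (((m1 \x m2) \x m3) A = \int[m3]_z (m1 \x m2) (ysection A z))%E.
Proof.
move=> mA; exact: (product_measure1_ysection (sigma_finite_product m1 m2) m3).
Qed.

Lemma vol3_ysection (R : realType)
    (A : set (measurableTypeR R * measurableTypeR R * measurableTypeR R)) :
  measurable A ->
  vol3 A = fine (\int[@lebesgue_measure R]_z
    ((@lebesgue_measure R \x @lebesgue_measure R)%E (ysection A z))).
Proof.
move=> mA; rewrite /vol3; congr fine.
exact: (@product_measure1_ysection_iter _ _ _ _ _ _ R
  (@lebesgue_measure R) (@lebesgue_measure R) (@lebesgue_measure R) A mA).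
Qed.

(** A cone of height 1 has one third of the area of its base.  Only slices at
    positive height are prescribed, so that the lemma applies whether or not the
    apex belongs to the set; the slice at height 0 lies on a line. *)
Lemma vol3_of_slices (R : realType)
    (A : set (measurableTypeR R * measurableTypeR R * measurableTypeR R)) (c : R) :
  measurable A ->
  (forall z : R, 0 < z <= 1 ->
    (@lebesgue_measure R \x @lebesgue_measure R)%E (ysection A z) = (c * z ^+ 2)%:E) ->
  (forall x y z, A (x, y, z) -> 0 <= z <= 1) ->
  (forall x y, A (x, y, 0) -> y = 0) ->
  vol3 A = c / 3.
Proof.
move=> mA Asl Asupp A0; rewrite vol3_ysection//.
transitivity (fine (\int[mu]_(z in `[0%R, 1%R]) (c * z ^+ 2)%:E)%E); last first.
  by rewrite integral_sqr01.
congr fine; rewrite [RHS]integral_mkcond.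
apply: eq_integral => z _; rewrite patchE mem_setE in_itv/=.
case: ifPn => [|z01]; last first.
  rewrite (_ : ysection A z = set0) ?measure0//.
  apply/seteqP; split => -[x y]//; rewrite /ysection/= inE => /Asupp.
  by apply/negP.
rewrite le_eqVlt => /andP[/predU1P[<- _|z0 z1]]; last by rewrite Asl// z0.
rewrite expr0n/= mulr0 /product_measure1 integral0_eq// => x _ /=.
apply/eqP; rewrite eq_le measure_ge0 andbT -(lebesgue_measure_set1 0).
apply: le_measure; rewrite ?inE//.
  exact/measurable_xsection/measurable_ysection.
by move=> y; rewrite /xsection /ysection/= !inE/= => /set_mem /A0.
Qed.

(** * The region between a chord and three lines *)

Lemma affine_ge0 (R : realType) (c d a b x : R) : 0 <= c * a + d -> 0 <= c * b + d ->
  a <= x <= b -> 0 <= c * x + d.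
Proof.
move=> ha hb /andP[ax xb]; have [c0|c0] := leP 0 c; nra.
Qed.

(** Homogeneous in [(x, z)]: at [z = 1] the maximum of three affine functions
    of [x], and in general the lower boundary of the cone over its epigraph. *)
Definition max3_lines (R : realType) (m0 b0 m1 b1 m2 b2 x z : R) : R :=
  Num.max (m0 * x + b0 * z) (Num.max (m1 * x + b1 * z) (m2 * x + b2 * z)).

Lemma measurable_max3_lines (R : realType) (m0 b0 m1 b1 m2 b2 : R)
    d (T : measurableType d) (x z : T -> R) :
  measurable_fun setT x -> measurable_fun setT z ->
  measurable_fun setT (fun t => max3_lines m0 b0 m1 b1 m2 b2 (x t) (z t)).
Proof.
move=> mx mz.
by apply: measurable_maxr; [|apply: measurable_maxr];
  apply: measurable_funD; apply: measurable_funM.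
Qed.

Lemma max3_linesZ (R : realType) (m0 b0 m1 b1 m2 b2 x z : R) : 0 < z ->
  z * max3_lines m0 b0 m1 b1 m2 b2 (x / z) 1 = max3_lines m0 b0 m1 b1 m2 b2 x z.
Proof.
move=> z0; rewrite /max3_lines !maxr_pMr ?(ltW z0)//.
by congr (Num.max _ (Num.max _ _)); field; rewrite gt_eqF.
Qed.

Lemma chord_above_max3 (R : realType) (l t1 t2 u m0 b0 m1 b1 m2 b2 s r z x : R) :
  l <= t1 <= t2 -> t2 <= u -> m0 <= m1 <= m2 ->
  m0 * t1 + b0 = m1 * t1 + b1 -> m1 * t2 + b1 = m2 * t2 + b2 ->
  s * l + r = m0 * l + b0 -> s * u + r = m2 * u + b2 -> 0 <= z ->
  l * z <= x <= u * z -> max3_lines m0 b0 m1 b1 m2 b2 x z <= s * x + r * z.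
Proof.
move=> /andP[lt1 t12] t2u /andP[m01 m12] e1 e2 el eu z0 hx.
have above m b : m * l + b <= s * l + r -> m * u + b <= s * u + r ->
    m * x + b * z <= s * x + r * z.
  move=> hl hu; rewrite -subr_ge0 (_ : _ - _ = (s - m) * x + (r - b) * z); last by ring.
  apply: affine_ge0 hx.
    by rewrite mulrA -mulrDl mulr_ge0//; lra.
  by rewrite mulrA -mulrDl mulr_ge0//; lra.
rewrite /max3_lines !ge_max; apply/and3P; split; apply: above; nra.
Qed.

(** The area between the chord [s * x + r] and the maximum of the three lines,
    as the sum of the three trapezoids cut out by the break points [t1], [t2]. *)
Definition max3_gap_area (R : realType) (l t1 t2 u m0 b0 m1 b1 m2 b2 s r : R) : R :=
  (t1 - l) * ((s - m0) * (l + t1) / 2 + (r - b0)) +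
  (t2 - t1) * ((s - m1) * (t1 + t2) / 2 + (r - b1)) +
  (u - t2) * ((s - m2) * (t2 + u) / 2 + (r - b2)).

Lemma integral_max3_gap (R : realType) (l t1 t2 u m0 b0 m1 b1 m2 b2 s r z : R) :
  l <= t1 <= t2 -> t2 <= u -> m0 <= m1 <= m2 ->
  m0 * t1 + b0 = m1 * t1 + b1 -> m1 * t2 + b1 = m2 * t2 + b2 ->
  s * l + r = m0 * l + b0 -> s * u + r = m2 * u + b2 -> 0 <= z ->
  (\int[mu]_(x in `[(l * z)%R, (u * z)%R])
    (s * x + r * z - max3_lines m0 b0 m1 b1 m2 b2 x z)%:E =
   (max3_gap_area l t1 t2 u m0 b0 m1 b1 m2 b2 s r * z ^+ 2)%:E)%E.
Proof.
move=> lt12 t2u m012 e1 e2 el eu z0.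
have gap0 x : l * z <= x <= u * z ->
    0 <= s * x + r * z - max3_lines m0 b0 m1 b1 m2 b2 x z.
  move=> hx; rewrite subr_ge0.
  exact: (chord_above_max3 lt12 t2u m012 e1 e2 el eu z0 hx).
move: lt12 m012 => /andP[lt1 t12] /andP[m01 m12].
have h1 : l * z <= t1 * z by rewrite ler_wpM2r.
have h2 : t1 * z <= t2 * z by rewrite ler_wpM2r.
have h3 : t2 * z <= u * z by rewrite ler_wpM2r.
have mg : measurable_fun setT
    (fun x => s * x + r * z - max3_lines m0 b0 m1 b1 m2 b2 x z).
  apply: measurable_funB; last exact: measurable_max3_lines.
  by apply: measurable_funD; apply: measurable_funM.
have piece (a b m c : R) : a <= b ->
    (forall x, a <= x <= b -> max3_lines m0 b0 m1 b1 m2 b2 x z = m * x + c * z) ->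
    (\int[mu]_(x in `[a, b]) (s * x + r * z - max3_lines m0 b0 m1 b1 m2 b2 x z)%:E =
     ((b - a) * ((s - m) * (a + b) / 2 + (r - c) * z))%:E)%E.
  move=> ab hm; rewrite -integral_affine//; apply: eq_integral => x.
  by rewrite inE/= in_itv/= => hx; congr EFin; rewrite hm//; ring.
rewrite (@ge0_integral_itv_split _ _ (t1 * z) _ _ _ _ mg)//; last by lra.
rewrite (@ge0_integral_itv_split _ (t1 * z) (t2 * z) (u * z) _ _ _ mg)//; last first.
  by move=> x hx; apply: gap0; lra.
rewrite (piece _ _ m0 b0)//; last first.
  by move=> x hx; rewrite /max3_lines max_l// ge_max; apply/andP; split; nra.
rewrite (piece _ _ m1 b1)//; last first.
  move=> x hx; rewrite /max3_lines.
  have -> : Num.max (m1 * x + b1 * z) (m2 * x + b2 * z) = m1 * x + b1 * z.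
    by rewrite max_l//; nra.
  by rewrite max_r//; nra.
rewrite (piece _ _ m2 b2)//; last first.
  move=> x hx; rewrite /max3_lines.
  have -> : Num.max (m1 * x + b1 * z) (m2 * x + b2 * z) = m2 * x + b2 * z.
    by rewrite max_r//; nra.
  by rewrite max_r//; nra.
by rewrite -!EFinD; congr EFin; rewrite /max3_gap_area; field.
Qed.

(** The first term is one third of the area of the triangle formed by the chord
    and the outer lines.  Removing the region above all three lines leaves the
    triangle formed by these lines.  Its vertical width [d] at [t] satisfies
    [d = (m1 - m0) * (t - t1) = (m2 - m1) * (t2 - t)], whence its area is
    [(m2 - m0) / 2 * (t - t1) * (t2 - t)]. *)
Lemma gap_area_tangents (R : realType) (l t1 t t2 u m0 b0 m1 b1 m2 b2 s r : R) :
  l < u -> t1 < t2 -> m0 < m2 ->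
  m0 * t1 + b0 = m1 * t1 + b1 -> m1 * t2 + b1 = m2 * t2 + b2 ->
  m0 * t + b0 = m2 * t + b2 ->
  s * l + r = m0 * l + b0 -> s * u + r = m2 * u + b2 ->
  (((m0 * l + b0) - (m2 * l + b2)) * ((m2 * u + b2) - (m0 * u + b0))) /
    (6 * (m2 - m0)) - max3_gap_area l t1 t2 u m0 b0 m1 b1 m2 b2 s r / 3 =
  (m2 - m0) / 6 * ((t - t1) * (t2 - t)).
Proof.
move=> lu t12 m02 e1 e2 e el eu.
have -> : r = m0 * l + b0 - s * l by lra.
have -> : s = (m2 * u + b2 - (m0 * l + b0)) / (u - l).
  by apply: (mulIf (lt0r_neq0 (_ : 0 < u - l))); [lra|rewrite divfK; lra].
have b2E : b2 = (m0 - m2) * t + b0 by lra.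
have b1E : b1 = (m0 - m1) * t1 + b0 by lra.
(* The two expressions of [d] determine the middle slope. *)
have m1E : m1 = (m2 * t2 - m0 * t1 - (m2 - m0) * t) / (t2 - t1).
  apply: (mulIf (lt0r_neq0 (_ : 0 < t2 - t1))); first by lra.
  rewrite divfK; nra.
rewrite /max3_gap_area b2E b1E m1E; field.
by rewrite !subr_eq0 !gt_eqF.
Qed.

(** * The convex body and its volume *)

Lemma line_through_affine (R : realType) (m c a b x : R) : a != b ->
  line_through a (m * a + c) b (m * b + c) x = m * x + c.
Proof.
move=> ab; rewrite /line_through /line_path /factor; field.
by rewrite subr_eq0 eq_sym.
Qed.

Definition tangent_max (R : realType) (p l xi u : R) : R -> R -> R :=
  max3_lines (pow_diff p l) (intercept p l) (pow_diff p xi) (intercept p xi)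
    (pow_diff p u) (intercept p u).

Lemma pw_under_tangent_max (R : realType) (p l xi u x : R) : 1 < p -> 0 <= l ->
  l < xi < u -> pw_under p l xi u x = tangent_max p l xi u x 1.
Proof.
move=> p1 l0 /andP[lxi xiu]; have xi0 : 0 <= xi by lra.
have e1 := tangent_meetP p1 l0 lxi; have e2 := tangent_meetP p1 xi0 xiu.
have /andP[lt1 t1xi] := tangent_meet_between p1 l0 lxi.
have /andP[xit2 t2u] := tangent_meet_between p1 xi0 xiu.
have d1 := pow_diff_lt p1 l0 lxi; have d2 := pow_diff_lt p1 xi0 xiu.
rewrite /pw_under /tangent_max /max3_lines !mulr1.
set t1 := tangent_meet p l xi in e1 lt1 t1xi *.
set t2 := tangent_meet p xi u in e2 xit2 t2u *.
have y1E : xi `^ p + pow_diff p xi * (t1 - xi) = pow_diff p xi * t1 + intercept p xi.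
  by rewrite /intercept; ring.
have y2E : u `^ p + pow_diff p u * (t2 - u) = pow_diff p u * t2 + intercept p u.
  by rewrite /intercept; ring.
rewrite y1E y2E -!tangent_touch.
case: (leP x t1) => xt1.
  by rewrite -e1 line_through_affine ?lt_eqF// max_l// ge_max; apply/andP; split; nra.
case: (leP x t2) => xt2.
  rewrite -e2 line_through_affine ?lt_eqF//; last by lra.
  by rewrite (max_l (_ : _ u * x + _ <= _)) ?max_r//; nra.
rewrite line_through_affine ?lt_eqF//.
by rewrite (max_r (_ : _ <= _ u * x + _)) ?max_r//; nra.
Qed.

(** Height 0 is allowed, which adds only the apex and makes the set closed. *)
Definition tangent_cone (R : realType) (p l xi u : R) : set (R * R * R) :=
  [set q | let: (x, y, z) := q in
    let s := chord_slope p l u in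
    [/\ 0 <= z <= 1, l * z <= x <= u * z &
      tangent_max p l xi u x z <= y <= s * x + (l `^ p - s * l) * z]].

(** The piecewise linear function is the maximum of the three tangents, and
    [z * g (x / z)] is its homogeneous form.  The inequality [0 <= y] comes from
    the tangent at [l], which is nonnegative to the right of [l]. *)
Lemma Ubreve_baseE (R : realType) (p l xi u : R) : 1 < p -> 0 <= l ->
  l < xi < u ->
  Ubreve_base p l xi u = tangent_cone p l xi u `&` [set q | 0 < q.2].
Proof.
move=> p1 l0 lxiu; apply/seteqP; split=> -[[x y] z] /=;
  rewrite /Ubreve_base /tangent_cone/=.
  move=> [hy hx /andP[z0 z1] y0]; split=> //; split=> //; first by rewrite ltW.
  move: hy; rewrite pw_under_tangent_max// /tangent_max max3_linesZ// => /andP[-> /=].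
  by rewrite addrC.
move=> [[/andP[_ z1] /[dup] hx /andP[lx xu] /[dup] hy /andP[ty _]] z0]; split=> //.
- rewrite pw_under_tangent_max// /tangent_max max3_linesZ// addrC//.
- by rewrite z0.
- apply: le_trans ty; rewrite /tangent_max /max3_lines le_max; apply/orP; left.
  have h := mulr_ge0 (powR_ge0 l p) (ltW z0).
  have d0 : 0 <= pow_diff p l by rewrite mulr_ge0 ?powR_ge0//; lra.
  have := tangent_touch p l; nra.
Qed.

Lemma tangent_cone_convex (R : realType) (p l xi u : R) :
  convex_set (tangent_cone p l xi u `&` [set q | 0 < q.2] :
    set (convex_lmodType (R^o * R^o * R^o)%type)).
Proof.
move=> [[x y] z] [[x' y'] z'] k; rewrite !inE /tangent_cone /tangent_max /max3_lines /=.
have c0 : 0 <= k%:num by []. have c1 : 0 <= 1 - k%:num by rewrite subr_ge0.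
set c := k%:num in c0 c1 *.
have conv a b a' b' : a <= b -> a' <= b' ->
    c * a + (1 - c) * a' <= c * b + (1 - c) * b'.
  by move=> h h'; rewrite lerD// ler_wpM2l.
rewrite !ge_max.
move=> [[/andP[a1 a2] /andP[a3 a4] /andP[/and3P[a5 a6 a7] a8]] a9].
move=> [[/andP[b1 b2] /andP[b3 b4] /andP[/and3P[b5 b6 b7] b8]] b9].
(* Strict positivity of the height, from the common lower bound [min z z']. *)
have zpos : 0 < c * z + (1 - c) * z'.
  have m0 : 0 < Num.min z z' by rewrite lt_min a9.
  apply: lt_le_trans (conv (Num.min z z') z (Num.min z z') z' _ _).
  - by rewrite -mulrDl subrKC mul1r.
  - by rewrite ge_min lexx.
  - by rewrite ge_min lexx orbT.
have h2 := conv _ _ _ _ a2 b2. have h3 := conv _ _ _ _ a3 b3.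
have h4 := conv _ _ _ _ a4 b4. have h5 := conv _ _ _ _ a5 b5.
have h6 := conv _ _ _ _ a6 b6. have h7 := conv _ _ _ _ a7 b7.
have h8 := conv _ _ _ _ a8 b8.
rewrite /unstable.onem /GRing.scale /=; split; last exact: zpos.
split; first by rewrite ltW//=; lra.
  by apply/andP; split; lra.
by apply/andP; split; last lra; apply/and3P; split; lra.
Qed.

Lemma closed_le_fun (T : topologicalType) (R : realType) (f g : T -> R) :
  continuous f -> continuous g -> closed [set q | f q <= g q].
Proof.
move=> cf cg.
have -> : [set q | f q <= g q] = (fun q => g q - f q) @^-1` [set x | 0 <= x].
  by apply/seteqP; split=> q /=; rewrite subr_ge0.
apply: preimage_closed; last exact: closed_ge.
by move=> q _; apply: cvgB; [exact: cg|exact: cf].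
Qed.

(** Closedness and measurability are read off from this system of inequalities. *)
Lemma tangent_coneE (R : realType) (p l xi u : R) :
  tangent_cone p l xi u = [set q | 0 <= q.2] `&` [set q | q.2 <= 1] `&`
    [set q | l * q.2 <= q.1.1] `&` [set q | q.1.1 <= u * q.2] `&`
    [set q | tangent_max p l xi u q.1.1 q.2 <= q.1.2] `&`
    [set q | q.1.2 <= chord_slope p l u * q.1.1 +
      (l `^ p - chord_slope p l u * l) * q.2].
Proof.
apply/seteqP; split=> -[[x y] z] /=; rewrite /tangent_cone/=.
  by move=> [/andP[? ?] /andP[? ?] /andP[? ?]].
by move=> [[[[[-> ->] ->] ->] ->] ->].
Qed.

Lemma tangent_cone_closed (R : realType) (p l xi u : R) :
  closed (tangent_cone p l xi u).
Proof.
have cx : continuous (fun q : R * R * R => q.1.1).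
  by move=> q; apply: (@continuous_comp _ _ _ fst fst); exact: cvg_fst.
have cy : continuous (fun q : R * R * R => q.1.2).
  by move=> q; apply: (@continuous_comp _ _ _ fst snd); [exact: cvg_fst|exact: cvg_snd].
have cz : continuous (fun q : R * R * R => q.2) by move=> q; exact: cvg_snd.
have cl a b : continuous (fun q : R * R * R => a * q.1.1 + b * q.2).
  by move=> q; apply: cvgD; apply: cvgMr; [exact: cx|exact: cz].
have cs a : continuous (fun q : R * R * R => a * q.2).
  by move=> q; apply: cvgMr; exact: cz.
have cst (a : R) : continuous (fun q : R * R * R => a) by move=> q; exact: cvg_cst.
have cm : continuous (fun q : R * R * R => tangent_max p l xi u q.1.1 q.2).
  exact: (max_fun_continuous (cl (pow_diff p l) (intercept p l))
    (max_fun_continuous (cl (pow_diff p xi) (intercept p xi))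
      (cl (pow_diff p u) (intercept p u)))).
rewrite tangent_coneE; do ?apply: closedI; apply: closed_le_fun;
  by [exact: cx|exact: cy|exact: cz|exact: cs|exact: cl|exact: cst|exact: cm].
Qed.

Lemma measurable_le_set d (T : measurableType d) (R : realType) (f g : T -> R) :
  measurable_fun setT f -> measurable_fun setT g -> measurable [set q | f q <= g q].
Proof.
move=> mf mg; rewrite -[X in measurable X]setTI.
have h := measurable_fun_ler mf mg; have := h measurableT [set true]; apply.
by [].
Qed.

Lemma tangent_cone_measurable (R : realType) (p l xi u : R) :
  measurable (tangent_cone p l xi u :
    set (measurableTypeR R * measurableTypeR R * measurableTypeR R)).
Proof.
pose T := (measurableTypeR R * measurableTypeR R * measurableTypeR R)%type.
have mx : measurable_fun setT (fun q : T => q.1.1 : R).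
  by apply: (@measurableT_comp _ _ _ _ _ _ fst _ fst); exact: measurable_fst.
have my : measurable_fun setT (fun q : T => q.1.2 : R).
  by apply: (@measurableT_comp _ _ _ _ _ _ snd _ fst);
    [exact: measurable_snd|exact: measurable_fst].
have mz : measurable_fun setT (fun q : T => q.2 : R) by exact: measurable_snd.
rewrite tangent_coneE; do ?apply: measurableI; apply: measurable_le_set => //.
- by apply: measurable_funM.
- by apply: measurable_funM.
- exact: measurable_max3_lines.
- by apply: measurable_funD; apply: measurable_funM.
Qed.

(** The base set is convex, hence equal to its convex hull, and its closure can
    only add the apex. *)
Lemma vol3_Ubreve (R : realType) (p l xi u : R) : 1 < p -> 0 <= l ->
  l < xi < u ->
  vol3 (Ubreve p l xi u) =
  max3_gap_area l (tangent_meet p l xi) (tangent_meet p xi u) u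
    (pow_diff p l) (intercept p l) (pow_diff p xi) (intercept p xi)
    (pow_diff p u) (intercept p u)
    (chord_slope p l u) (l `^ p - chord_slope p l u * l) / 3.
Proof.
move=> p1 l0 /[dup] lxiu /andP[lxi xiu].
have xi0 : 0 <= xi by lra. have lu : l < u by lra.
set K := tangent_cone p l xi u.
set K0 := K `&` [set q | 0 < q.2].
have UE : Ubreve p l xi u = closure K0.
  by rewrite /Ubreve /convex_hull3 Ubreve_baseE// smallest_id//;
    exact: tangent_cone_convex.
have K0A : K0 `<=` Ubreve p l xi u by rewrite UE; exact: subset_closure.
have AK : Ubreve p l xi u `<=` K.
  have KE : K = closure K by exact/closure_id/tangent_cone_closed.
  by rewrite UE KE; apply: closureS; exact: subIsetl.
have apex x y z : K (x, y, z) -> z <= 0 -> (x, y, z) = (0, 0, 0).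
  move=> [/andP[z0 _] hx hy] z0'.
  have zE : z = 0 by apply/eqP; rewrite eq_le z0'.
  have xE : x = 0 by rewrite zE in hx; lra.
  rewrite zE xE in hy *; congr (_, _, _).
  by move: hy; rewrite /tangent_max /max3_lines !mulr0 !addr0 !maxxx -eq_le => /eqP.
(* The closure is the full cone or the cone without its apex, and both are
   measurable. *)
have mA : measurable (Ubreve p l xi u :
    set (measurableTypeR R * measurableTypeR R * measurableTypeR R)).
  have mK := @tangent_cone_measurable R p l xi u.
  have [A0|A0] := pselect (Ubreve p l xi u (0, 0, 0)).
    rewrite (_ : Ubreve p l xi u = K)//; apply/seteqP; split=> // -[[x y] z] Kq.
    have [/(apex _ _ _ Kq) ->//|z0] := leP z 0.
    by apply: K0A; split.
  rewrite (_ : Ubreve p l xi u = K0).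
    apply: measurableI => //.
    rewrite (_ : [set q | 0 < q.2] = ~` [set q | q.2 <= 0]).
      by apply/measurableC/measurable_le_set => //; exact: measurable_snd.
    by apply/seteqP; split=> q /=; [rewrite ltNge => /negP|move/negP; rewrite -ltNge].
  apply/seteqP; split=> // -[[x y] z] Aq; split; first exact: AK.
  rewrite /= ltNge; apply/negP => /(apex _ _ _ (AK _ Aq)) e.
  by apply: A0; rewrite -e.
apply: vol3_of_slices => //.
- move=> z /andP[z0 z1].
  have e1 := tangent_meetP p1 l0 lxi; have e2 := tangent_meetP p1 xi0 xiu.
  have /andP[lt1 t1xi] := tangent_meet_between p1 l0 lxi.
  have /andP[xit2 t2u] := tangent_meet_between p1 xi0 xiu.
  have d1 := pow_diff_lt p1 l0 lxi; have d2 := pow_diff_lt p1 xi0 xiu.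
  have lt12 : l <= tangent_meet p l xi <= tangent_meet p xi u by lra.
  have m012 : pow_diff p l <= pow_diff p xi <= pow_diff p u by lra.
  set s := chord_slope p l u; set r := l `^ p - s * l.
  have el : s * l + r = pow_diff p l * l + intercept p l.
    by rewrite tangent_touch /r; ring.
  have eu : s * u + r = pow_diff p u * u + intercept p u.
    by rewrite tangent_touch /r /s /chord_slope; field; rewrite subr_eq0 gt_eqF.
  rewrite (@measure_between_graphs _ (l * z) (u * z)
    (fun x => tangent_max p l xi u x z) (fun x => s * x + r * z)).
  + exact: (integral_max3_gap lt12 (ltW t2u) m012 e1 e2 el eu (ltW z0)).
  + move=> x hx.
    exact: (chord_above_max3 lt12 (ltW t2u) m012 e1 e2 el eu (ltW z0) hx).
  + move=> x y; rewrite /ysection/= inE; split=> [/AK[]//|[hx hy]].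
    by apply: K0A; split=> //=; split=> //; rewrite (ltW z0).
- by move=> x y z /AK[].
- by move=> x y /AK Kxy; case: (apex _ _ _ Kxy (lexx 0)).
Qed.

(** * Strict log-concavity *)

Theorem theorem3p17 (R : realType) (p l u : R) (hl : 0 <= l) (hlu : l < u)
    (hp : 2 < p) :
  strictly_log_concave_on `]l, u[ (hfun p l u).
Proof.
have p1 : 1 < p by lra.
pose t := tangent_meet p l u; have et := tangent_meetP p1 hl hlu.
pose c := (pow_diff p u - pow_diff p l) / 6.
have c0 : 0 < c by rewrite divr_gt0// subr_gt0 pow_diff_lt.
(* [hfun] is the volume of the cone over the triangle cut off by the tangent at
   [x] from the triangle of the chord and the two outer tangents. *)
have hE x : l < x < u ->
    hfun p l u x = c * ((t - tangent_meet p l x) * (tangent_meet p x u - t)).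
  move=> lxu; move: (lxu) => /andP[lx xu]; have x0 : 0 <= x by lra.
  have t12 : tangent_meet p l x < tangent_meet p x u.
    have := tangent_meet_between p1 hl lx; have := tangent_meet_between p1 x0 xu; lra.
  have el : chord_slope p l u * l + (l `^ p - chord_slope p l u * l) =
      pow_diff p l * l + intercept p l by rewrite tangent_touch; ring.
  have eu : chord_slope p l u * u + (l `^ p - chord_slope p l u * l) =
      pow_diff p u * u + intercept p u.
    by rewrite tangent_touch /chord_slope; field; rewrite subr_eq0 gt_eqF.
  rewrite /hfun vol3_Ubreve// /c -(gap_area_tangents hlu t12 (pow_diff_lt p1 hl hlu)
    (tangent_meetP p1 hl lx) (tangent_meetP p1 x0 xu) et el eu).
  congr (_ - _); rewrite /Cconst /intercept /pow_diff.
  rewrite -!(@mulr_powRB1 _ _ p)//; try lra.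
  by congr (_ / _); ring.
(* From here on only this product formula matters. *)
move: c c0 (hfun p l u) hE => c c0 h hE.
have pos1 x : l < x < u -> 0 < t - tangent_meet p l x.
  by move=> /andP[lx xu]; rewrite subr_gt0 tangent_meet_ltr.
have pos2 x : l < x < u -> 0 < tangent_meet p x u - t.
  by move=> /andP[lx xu]; rewrite subr_gt0 tangent_meet_ltl.
split.
  by move=> x; rewrite /= in_itv/= => lxu; rewrite hE// !mulr_gt0 ?pos1 ?pos2//.
move=> x y k; rewrite /= !in_itv/= => lxu lyu xy k0 k1.
have lmu : l < k * x + (1 - k) * y < u by nra.
have lnE z : l < z < u -> ln (h z) =
    ln c + (ln (t - tangent_meet p l z) + ln (tangent_meet p z u - t)).
  by move=> lzu; rewrite hE// !lnM ?posrE ?mulr_gt0 ?pos1 ?pos2//.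
rewrite !lnE//.
have := ln_left_gap_strictly_concave hp hl lxu lyu xy k0 k1.
have := ln_right_gap_concave hp hl lxu lyu k0 k1.
rewrite -/t; lra.
Qed.
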